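(* The following assertions hold over $\mathsf{Int2GC}$. (a) The axioms (FS1) $\Diamond(A\to B)\to(\Box A\to\Diamond B)$ and (FS4) $(\dot{\Diamond} A\to\blacksquare B)\to\blacksquare(A\to B)$ are equivalent. (b) The axioms (FS2) $\dot{\Diamond}(A\to B)\to(\blacksquare A\to\dot{\Diamond} B)$ and (FS3) $(\Diamond A\to\Box B)\to\Box(A\to B)$ are equivalent. Here two axiom schemes are equivalent if adding all instances of either one to $\mathsf{Int2GC}$ (and closing under the rules of $\mathsf{Int2GC}$) makes all instances of the other provable.
   Context: $\Phi$ is the set of formulas built from a countably infinite set of propositional variables with $\neg,\vee,\wedge,\to$ and the unary operators $\Diamond,\Box,\dot{\Diamond},\blacksquare$. $\mathsf{Int2GC}$ is the smallest set of formulas of $\Phi$ that contains all instances (in the language $\Phi$) of theorems of intuitionistic propositional logic and is closed under modus ponens and the four rules: from $A\to\blacksquare B$ infer $\Diamond A\to B$; from $\Diamond A\to B$ infer $A\to\blacksquare B$; from $A\to\Box B$ infer $\dot{\Diamond} A\to B$; from $\dot{\Diamond} A\to B$ infer $A\to\Box B$. *)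

(* Defs.v *)
(* Formulas of intuitionistic propositional logic; negation is primitive. *)
Inductive pform : Type :=
| PVar : nat -> pform
| PNeg : pform -> pform
| POr  : pform -> pform -> pform
| PAnd : pform -> pform -> pform
| PImp : pform -> pform -> pform.

(* Kleene's Hilbert-style axiomatization. *)
Inductive IPL : pform -> Prop :=
| IPL_K    : forall A B, IPL (PImp A (PImp B A))
| IPL_S    : forall A B C,
    IPL (PImp (PImp A (PImp B C)) (PImp (PImp A B) (PImp A C)))
| IPL_andI : forall A B, IPL (PImp A (PImp B (PAnd A B)))
| IPL_andl : forall A B, IPL (PImp (PAnd A B) A)
| IPL_andr : forall A B, IPL (PImp (PAnd A B) B)
| IPL_orl  : forall A B, IPL (PImp A (POr A B))
| IPL_orr  : forall A B, IPL (PImp B (POr A B))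
| IPL_orE  : forall A B C,
    IPL (PImp (PImp A C) (PImp (PImp B C) (PImp (POr A B) C)))
| IPL_negI : forall A B,
    IPL (PImp (PImp A B) (PImp (PImp A (PNeg B)) (PNeg A)))
| IPL_negE : forall A B, IPL (PImp (PNeg A) (PImp A B))
| IPL_mp   : forall A B, IPL (PImp A B) -> IPL A -> IPL B.

(* [Dia], [Box] are the plain operators; [DDia] is the dotted diamond and
   [BBox] the black box. *)
Inductive form : Type :=
| Var  : nat -> form
| Neg  : form -> form
| Or   : form -> form -> form
| And  : form -> form -> form
| Imp  : form -> form -> form
| Dia  : form -> form
| Box  : form -> form
| DDia : form -> form
| BBox : form -> form.

Fixpoint subst (s : nat -> form) (P : pform) : form :=
  match P with
  | PVar n   => s n
  | PNeg P   => Neg (subst s P)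
  | POr P Q  => Or (subst s P) (subst s Q)
  | PAnd P Q => And (subst s P) (subst s Q)
  | PImp P Q => Imp (subst s P) (subst s Q)
  end.

Definition IPL_instance (F : form) : Prop :=
  exists (P : pform) (s : nat -> form), IPL P /\ F = subst s P.

(* The smallest set of formulas containing [X] and closed under modus ponens
   and the rules of the Galois connections Dia -| BBox and DDia -| Box. *)
Inductive closure (X : form -> Prop) : form -> Prop :=
| cl_base : forall F, X F -> closure X F
| cl_mp : forall A B, closure X (Imp A B) -> closure X A -> closure X B
| cl_BBox_Dia : forall A B, closure X (Imp A (BBox B)) -> closure X (Imp (Dia A) B)
| cl_Dia_BBox : forall A B, closure X (Imp (Dia A) B) -> closure X (Imp A (BBox B))
| cl_Box_DDia : forall A B, closure X (Imp A (Box B)) -> closure X (Imp (DDia A) B)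
| cl_DDia_Box : forall A B, closure X (Imp (DDia A) B) -> closure X (Imp A (Box B)).

Definition Int2GC : form -> Prop := closure IPL_instance.

(* An axiom scheme in two metavariables. *)
Definition scheme : Type := form -> form -> form.

Definition Int2GC_plus (S : scheme) : form -> Prop :=
  closure (fun F => Int2GC F \/ exists A B : form, F = S A B).

Definition equivalent_over_Int2GC (S T : scheme) : Prop :=
  (forall A B : form, Int2GC_plus S (T A B)) /\
  (forall A B : form, Int2GC_plus T (S A B)).

Definition FS1 : scheme := fun A B =>
  Imp (Dia (Imp A B)) (Imp (Box A) (Dia B)).
Definition FS2 : scheme := fun A B =>
  Imp (DDia (Imp A B)) (Imp (BBox A) (DDia B)).
Definition FS3 : scheme := fun A B =>
  Imp (Imp (Dia A) (Box B)) (Box (Imp A B)).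
Definition FS4 : scheme := fun A B =>
  Imp (Imp (DDia A) (BBox B)) (BBox (Imp A B)).

(* Main.v *)
Require Import Defs.

(** The operators form two adjoint pairs, [Dia -| BBox] and [DDia -| Box], and
    everything follows from their units and counits.

    By adjunction an instance of FS4 says that [Dia (DDia A -> BBox B)] implies
    [A -> B].  FS1 for [DDia A] and [BBox B] sends the former to
    [Box (DDia A) -> Dia (BBox B)], and this implies [A -> B] by the unit
    [A -> Box (DDia A)] and the counit [Dia (BBox B) -> B].  Conversely, an
    instance of FS1 says that [A -> B] implies [BBox (Box A -> Dia B)].  By the
    counit [DDia (Box A) -> A] and the unit [B -> BBox (Dia B)], [A -> B] implies
    [DDia (Box A) -> BBox (Dia B)], to which FS4 applies.

    Exchanging the two adjoint pairs turns FS1 into FS2 and FS4 into FS3, so the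
    argument is carried out once, in [galois_FS4_of_FS1] and [galois_FS1_of_FS4],
    for two arbitrary adjoint pairs over a set of formulas containing the
    implicational part of intuitionistic logic. *)

(** Closure under the positive implicational calculus is all that the argument
    uses of intuitionistic logic. *)
Record implicational (D : form -> Prop) : Prop := {
  imp_K : forall A B, D (Imp A (Imp B A));
  imp_S : forall A B C,
    D (Imp (Imp A (Imp B C)) (Imp (Imp A B) (Imp A C)));
  imp_mp : forall A B, D (Imp A B) -> D A -> D B
}.

Definition galois (D : form -> Prop) (f g : form -> form) : Prop :=
  forall A B, D (Imp (f A) B) <-> D (Imp A (g B)).

Lemma imp_refl (D : form -> Prop) (HD : implicational D) (A : form) :
  D (Imp A A).
Proof.
apply (imp_mp D HD (Imp A (Imp A A))); [| apply (imp_K D HD)].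
apply (imp_mp D HD (Imp A (Imp (Imp A A) A))); [| apply (imp_K D HD)].
apply (imp_S D HD).
Qed.

Lemma imp_postcomp (D : form -> Prop) (HD : implicational D) (A B C : form) :
  D (Imp B C) -> D (Imp (Imp A B) (Imp A C)).
Proof.
intros HBC.
apply (imp_mp D HD (Imp A (Imp B C))); [apply (imp_S D HD) |].
exact (imp_mp D HD _ _ (imp_K D HD _ _) HBC).
Qed.

Lemma imp_trans (D : form -> Prop) (HD : implicational D) (A B C : form) :
  D (Imp A B) -> D (Imp B C) -> D (Imp A C).
Proof.
intros HAB HBC.
exact (imp_mp D HD _ _ (imp_postcomp D HD A B C HBC) HAB).
Qed.

Lemma imp_precomp (D : form -> Prop) (HD : implicational D) (A B C : form) :
  D (Imp A B) -> D (Imp (Imp B C) (Imp A C)).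
Proof.
intros HAB.
(* S turns [A -> (B -> C)] into [(A -> B) -> (A -> C)]; K then lets the theorem
   [A -> B] be fed to it under the hypothesis [B -> C]. *)
apply (imp_mp D HD (Imp (Imp B C) (Imp A B)));
  [| exact (imp_mp D HD _ _ (imp_K D HD _ _) HAB)].
apply (imp_mp D HD (Imp (Imp B C) (Imp (Imp A B) (Imp A C))));
  [apply (imp_S D HD) |].
apply (imp_trans D HD _ (Imp A (Imp B C))); [apply (imp_K D HD) |].
apply (imp_S D HD).
Qed.

Lemma imp_bimap (D : form -> Prop) (HD : implicational D) (A A' B B' : form) :
  D (Imp A' A) -> D (Imp B B') -> D (Imp (Imp A B) (Imp A' B')).
Proof.
intros HA HB.
apply (imp_trans D HD _ (Imp A' B)).
- apply (imp_precomp D HD); exact HA.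
- apply (imp_postcomp D HD); exact HB.
Qed.

Lemma galois_unit (D : form -> Prop) (HD : implicational D)
  (f g : form -> form) (Hfg : galois D f g) (A : form) :
  D (Imp A (g (f A))).
Proof. apply Hfg, (imp_refl D HD). Qed.

Lemma galois_counit (D : form -> Prop) (HD : implicational D)
  (f g : form -> form) (Hfg : galois D f g) (A : form) :
  D (Imp (f (g A)) A).
Proof. apply Hfg, (imp_refl D HD). Qed.

(** Transposing along [f -| g], the goal becomes the given scheme at [h A] and
    [g B] followed by the unit of [h -| k] and the counit of [f -| g]. *)
Lemma galois_FS4_of_FS1 (D : form -> Prop) (HD : implicational D)
  (f g h k : form -> form) (Hfg : galois D f g) (Hhk : galois D h k)
  (HFS : forall A B, D (Imp (f (Imp A B)) (Imp (k A) (f B)))) (A B : form) :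
  D (Imp (Imp (h A) (g B)) (g (Imp A B))).
Proof.
apply Hfg.
apply (imp_trans D HD _ (Imp (k (h A)) (f (g B)))); [apply HFS |].
apply (imp_bimap D HD).
- exact (galois_unit D HD h k Hhk A).
- exact (galois_counit D HD f g Hfg B).
Qed.

(** Transposing along [f -| g], the goal becomes the counit of [h -| k] and the
    unit of [f -| g] followed by the given scheme at [k A] and [f B]. *)
Lemma galois_FS1_of_FS4 (D : form -> Prop) (HD : implicational D)
  (f g h k : form -> form) (Hfg : galois D f g) (Hhk : galois D h k)
  (HFS : forall A B, D (Imp (Imp (h A) (g B)) (g (Imp A B)))) (A B : form) :
  D (Imp (f (Imp A B)) (Imp (k A) (f B))).
Proof.
apply Hfg.
apply (imp_trans D HD _ (Imp (h (k A)) (g (f B)))); [| apply HFS].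
apply (imp_bimap D HD).
- exact (galois_counit D HD h k Hhk A).
- exact (galois_unit D HD f g Hfg B).
Qed.

Lemma Int2GC_plus_implicational (S : scheme) : implicational (Int2GC_plus S).
Proof.
split.
- intros A B; apply cl_base; left; apply cl_base.
  exists (PImp (PVar 0) (PImp (PVar 1) (PVar 0))).
  exists (fun n => match n with 0 => A | _ => B end).
  split; [apply IPL_K | reflexivity].
- intros A B C; apply cl_base; left; apply cl_base.
  exists (PImp (PImp (PVar 0) (PImp (PVar 1) (PVar 2)))
               (PImp (PImp (PVar 0) (PVar 1)) (PImp (PVar 0) (PVar 2)))).
  exists (fun n => match n with 0 => A | 1 => B | _ => C end).
  split; [apply IPL_S | reflexivity].
- intros A B; apply cl_mp.
Qed.

Lemma closure_galois_Dia_BBox (X : form -> Prop) : galois (closure X) Dia BBox.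
Proof. intros A B; split; [apply cl_Dia_BBox | apply cl_BBox_Dia]. Qed.

Lemma closure_galois_DDia_Box (X : form -> Prop) : galois (closure X) DDia Box.
Proof. intros A B; split; [apply cl_DDia_Box | apply cl_Box_DDia]. Qed.

Lemma Int2GC_plus_instance (S : scheme) (A B : form) : Int2GC_plus S (S A B).
Proof. apply cl_base; right; exists A, B; reflexivity. Qed.

Theorem proposition2p1 :
  equivalent_over_Int2GC FS1 FS4 /\ equivalent_over_Int2GC FS2 FS3.
Proof.
split; split.
- exact (galois_FS4_of_FS1 _ (Int2GC_plus_implicational FS1) Dia BBox DDia Box
           (closure_galois_Dia_BBox _) (closure_galois_DDia_Box _)
           (Int2GC_plus_instance FS1)).
- exact (galois_FS1_of_FS4 _ (Int2GC_plus_implicational FS4) Dia BBox DDia Box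
           (closure_galois_Dia_BBox _) (closure_galois_DDia_Box _)
           (Int2GC_plus_instance FS4)).
- exact (galois_FS4_of_FS1 _ (Int2GC_plus_implicational FS2) DDia Box Dia BBox
           (closure_galois_DDia_Box _) (closure_galois_Dia_BBox _)
           (Int2GC_plus_instance FS2)).
- exact (galois_FS1_of_FS4 _ (Int2GC_plus_implicational FS3) DDia Box Dia BBox
           (closure_galois_DDia_Box _) (closure_galois_Dia_BBox _)
           (Int2GC_plus_instance FS3)).
Qed.
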